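(* Let $(k,|\cdot|_k)$ be a field that is complete with respect to a nontrivial non-Archimedean absolute value, and let $n\ge 1$. Let $\mathbf{A}^{n,\mathrm{hyb}}_k$ be the hybrid analytification of affine $n$-space over $k$ and $\mathbf{A}^{n,\mathrm{triv}}_k$ its fibre over the trivial norm. Then the inclusion $\mathbf{A}^{n,\mathrm{triv}}_k\hookrightarrow\mathbf{A}^{n,\mathrm{hyb}}_k$ is a homotopy equivalence.
   Context: $|\cdot|_0$ is the trivial norm on $k$ ($|0|_0=0$, $|a|_0=1$ for $a\ne0$). The hybrid norm is $\|a\|_{\mathrm{hyb}}=\max\{|a|_k,|a|_0\}$. A multiplicative seminorm on a ring $B$ is a map $|\cdot|\colon B\to\mathbf{R}_{\ge 0}$ with $|0|=0$, $|1|=1$, $|fg|=|f||g|$, $|f+g|\le |f|+|g|$. $\mathbf{A}^{n,\mathrm{hyb}}_k$ is the set of multiplicative seminorms $x$ on $k[T_1,\dots,T_n]$ (write $|f(x)|$ for the value of $x$ at $f$) with $|a(x)|\le\|a\|_{\mathrm{hyb}}$ for all $a\in k$, with the coarsest topology making $x\mapsto|f(x)|$ continuous for every $f\in k[T_1,\dots,T_n]$. The restriction of such a seminorm to $k$ is $|\cdot|_k^\rho$ for a unique $\rho\in[0,1]$ (with $|\cdot|_k^0$ meaning $|\cdot|_0$), giving a continuous map $\lambda\colon\mathbf{A}^{n,\mathrm{hyb}}_k\to[0,1]$. Put $\mathbf{A}^{n,\mathrm{triv}}_k=\lambda^{-1}(0)$. *)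

(* Defs.v *)
From HB Require Import structures.
From mathcomp Require Import all_boot all_order all_algebra.
From mathcomp Require Import all_classical all_reals all_analysis.
(* The notations of mpoly clash with those of MathComp-Analysis. *)
From mathcomp Require mpoly.
Import -(notations) mathcomp.multinomials.mpoly.
Import Order.TTheory GRing.Theory Num.Theory.
Import numFieldNormedType.Exports.

Set Implicit Arguments.
Unset Strict Implicit.
Unset Printing Implicit Defensive.

Local Open Scope classical_set_scope.
Local Open Scope ring_scope.

Section Norms.
Context {R : realType} {k : fieldType}.
Implicit Types (v : k -> R) (rho : R) (a b : k).

Record nonarchimedean_absolute_value v : Prop := NonArchAbs {
  absv_ge0 : forall a, 0 <= v a;
  absv_eq0 : forall a, v a = 0 <-> a = 0;
  absvM : forall a b, v (a * b) = v a * v b;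
  absv_ultra : forall a b, v (a + b) <= Num.max (v a) (v b) }.

Definition nontrivial_absolute_value v := exists2 a, a != 0 & v a != 1.

Definition complete_absolute_value v := forall u : nat -> k,
  (forall e : R, 0 < e ->
    exists N, forall i j, (N <= i)%N -> (N <= j)%N -> v (u i - u j) < e) ->
  exists l, forall e : R, 0 < e ->
    exists N, forall i, (N <= i)%N -> v (u i - l) < e.

Definition trivial_norm a : R := if a == 0 then 0 else 1.

Definition hybrid_norm v a : R := Num.max (v a) (trivial_norm a).

(* The case rho = 0 is separate because powR gives 0 `^ 0 = 1. *)
Definition abs_pow v rho a : R :=
  if rho == 0 then trivial_norm a else v a `^ rho.

End Norms.

Record multiplicative_seminorm {R : realType} {B : comNzRingType}
    (x : B -> R) : Prop := MulSeminorm {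
  msn_ge0 : forall f, 0 <= x f;
  msn0 : x 0 = 0;
  msn1 : x 1 = 1;
  msnM : forall f g, x (f * g) = x f * x g;
  msnD : forall f g, x (f + g) <= x f + x g }.

Definition hybrid_affine_space {R : realType} {k : fieldType}
    (v : k -> R) (n : nat) : Type :=
  {x : mpoly n k -> R | multiplicative_seminorm x /\
     forall a : k, x (mpolyC n a) <= hybrid_norm v a}.

Section HybridAffineSpace.
Context {R : realType} {k : fieldType} (v : k -> R) (n : nat).
Local Notation A_hyb := (hybrid_affine_space v n).

HB.instance Definition _ := gen_eqMixin A_hyb.
HB.instance Definition _ := gen_choiceMixin A_hyb.

Definition seminorm_eval (f : mpoly n k) (x : A_hyb) : R := proj1_sig x f.

HB.instance Definition _ := Topological.copy A_hyb
  (sup_topology (fun f : mpoly n k =>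
     Topological.class (initial_topology (seminorm_eval f)))).

Definition restricts_to_pow (x : A_hyb) (rho : R) : Prop :=
  0 <= rho <= 1 /\
  forall a : k, seminorm_eval (mpolyC n a) x = abs_pow v rho a.

(* The default value is never used: see hybrid_mapP below. *)
Definition hybrid_map (x : A_hyb) : R := xget 1 (restricts_to_pow x).

Definition trivial_fiber : set A_hyb := [set x | hybrid_map x = 0].

End HybridAffineSpace.

Arguments trivial_fiber {R k} v n _.

Section HybridMapTheory.
Context {R : realType} {k : fieldType} (v : k -> R) (n : nat).
Hypothesis v_abs : nonarchimedean_absolute_value v.
Hypothesis v_nontriv : nontrivial_absolute_value v.
Implicit Types (x : hybrid_affine_space v n) (a b : k).

Let v0 : v 0 = 0. Proof. exact/(absv_eq0 v_abs). Qed.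

Let v_gt0 a : a != 0 -> 0 < v a.
Proof.
move=> a0; rewrite lt_def (absv_ge0 v_abs) andbT.
by apply: contra_neq a0 => /(absv_eq0 v_abs).
Qed.

Let v1 : v 1 = 1.
Proof.
have v1n0 : v 1 != 0 by rewrite gt_eqF// v_gt0// oner_neq0.
by apply: (mulfI v1n0); rewrite -(absvM v_abs) !mulr1.
Qed.

Let v_small : exists2 p, p != 0 & v p < 1.
Proof.
case: v_nontriv => a a0; case: (ltgtP (v a) 1) => // va _.
  by exists a.
exists a^-1; first by rewrite invr_neq0.
have := absvM v_abs a a^-1; rewrite divff// v1 => /esym e.
by rewrite -e ltr_pMl// v_gt0// invr_neq0.
Qed.

Lemma restricts_to_pow_exists_unique x : exists! rho, restricts_to_pow x rho.
Proof.
pose w a := seminorm_eval (mpolyC n a) x.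
have [xsn xle] := proj2_sig x.
have wM a b : w (a * b) = w a * w b.
  by rewrite /w /seminorm_eval mpolyCM (msnM xsn).
have w1 : w 1 = 1 by rewrite /w /seminorm_eval mpolyC1 (msn1 xsn).
have w0 : w 0 = 0 by rewrite /w /seminorm_eval mpolyC0 (msn0 xsn).
have w_gt0 a : a != 0 -> 0 < w a.
  move=> a0; rewrite lt_def (msn_ge0 xsn) andbT; apply/eqP => wa0.
  have := wM a a^-1; rewrite divff// w1 wa0 mul0r => /eqP.
  by rewrite oner_eq0.
have wle a : a != 0 -> w a <= Num.max (v a) 1.
  by move=> a0; have := xle a; rewrite /hybrid_norm /trivial_norm (negbTE a0).
pose l a := ln (v a); pose L a := ln (w a).
have lM a b : a != 0 -> b != 0 -> l (a * b) = l a + l b.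
  by move=> a0 b0; rewrite /l (absvM v_abs) lnM ?posrE ?v_gt0.
have LM a b : a != 0 -> b != 0 -> L (a * b) = L a + L b.
  by move=> a0 b0; rewrite /L wM lnM ?posrE ?w_gt0.
have l1 : l 1 = 0 by rewrite /l v1 ln1.
have L1 : L 1 = 0 by rewrite /L w1 ln1.
have homX (h : k -> R) : h 1 = 0 ->
    (forall a b, a != 0 -> b != 0 -> h (a * b) = h a + h b) ->
    forall a (m : nat), a != 0 -> h (a ^+ m) = m%:R * h a.
  move=> h1 hM a m a0; elim: m => [|m IH]; first by rewrite expr0 mul0r.
  by rewrite exprS hM ?expf_neq0// IH -natr1 mulrDl mul1r addrC.
have homV (h : k -> R) : h 1 = 0 ->
    (forall a b, a != 0 -> b != 0 -> h (a * b) = h a + h b) ->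
    forall a, a != 0 -> h a^-1 = - h a.
  move=> h1 hM a a0; apply/eqP; rewrite -addr_eq0 addrC -hM ?invr_neq0//.
  by rewrite divff// h1.
have homZ (h : k -> R) : h 1 = 0 ->
    (forall a b, a != 0 -> b != 0 -> h (a * b) = h a + h b) ->
    forall a (m : int), a != 0 -> h (a ^ m) = m%:~R * h a.
  move=> h1 hM a [m|m] a0.
    by rewrite -exprnP (homX h)// -pmulrn.
  by rewrite NegzE -exprnN (homV h) ?expf_neq0// (homX h)// mulrNz mulNr.
have lL a : a != 0 -> l a <= 0 -> L a <= 0.
  move=> a0 la; apply: ln_le0.
  have va : v a <= 1.
    by rewrite leNgt; apply/negP => /ln_gt0; rewrite ltNge la.
  by apply: (le_trans (wle a a0)); rewrite ge_max va lexx.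
have [p p0 vp] := v_small.
have lp : l p < 0 by rewrite ln_lt0// v_gt0.
pose rho := L p / l p.
have Lp0 : L p <= 0 by apply: lL => //; exact: ltW.
have half a : a != 0 -> L a <= rho * l a.
  move=> a0; rewrite leNgt; apply/negP; rewrite -subr_gt0.
  set D := L a - _ => D0.
  pose m := Num.bound (- L p / D).
  have mD : - L p < m%:R * D.
    rewrite -ltr_pdivrMr//; apply: archi_boundP.
    by rewrite divr_ge0 ?oppr_ge0// ltW.
  pose j := Num.ceil (- (m%:R * l a / l p)).
  have /andP[jgt jge] := ceil_itv (- (m%:R * l a / l p)).
  have j0 : a ^+ m * p ^ j != 0 by rewrite mulf_neq0 ?expf_neq0 ?expfz_neq0.
  have ljle : l (a ^+ m * p ^ j) <= 0.
    rewrite lM ?expf_neq0 ?expfz_neq0// (homX l)// (homZ l)//.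
    move: jge => /(ler_wnM2r (ltW lp)); rewrite mulNr divfK ?lt_eqF//.
    by move=> h; rewrite -lerBrDl sub0r.
  have := lL _ j0 ljle.
  rewrite LM ?expf_neq0 ?expfz_neq0// (homX L)// (homZ L)// => Lj.
  have jub : j%:~R < - (m%:R * l a / l p) + 1.
    by rewrite -ltrBlDr -[1]/(1%:~R) -intrB.
  have : (- (m%:R * l a / l p) + 1) * L p <= j%:~R * L p.
    by apply: ler_wnM2r => //; exact: ltW.
  rewrite mulrDl mul1r => h.
  have e : m%:R * D = m%:R * L a - (m%:R * l a / l p) * L p.
    rewrite /D /rho mulrBr [L p / l p]mulrC -!mulrA; congr (_ - _ * _).
    by rewrite mulrA mulrC.
  move: mD; rewrite e -[X in _ < X]opprK ltrN2 opprB => mD.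
  have : m%:R * L a + j%:~R * L p >= m%:R * L a - m%:R * l a / l p * L p + L p.
    by rewrite -addrA lerD2l -mulNr.
  move=> /le_trans /(_ Lj); rewrite -lerBrDr sub0r leNgt => /negP; apply.
  by rewrite -ltrN2 opprK opprB.
have LE a : a != 0 -> L a = rho * l a.
  move=> a0; apply/eqP; rewrite eq_le half//=.
  have := half a^-1; rewrite invr_neq0// => /(_ isT).
  by rewrite (homV l)// (homV L)// mulrN lerN2.
have rho_ge0 : 0 <= rho by rewrite /rho mulr_le0 ?invr_le0// ltW.
have rho_le1 : rho <= 1.
  have pV0 : p^-1 != 0 by rewrite invr_neq0.
  have lV : 0 < l p^-1 by rewrite (homV l)// oppr_gt0.
  have vV : 1 <= v p^-1.
    rewrite leNgt; apply/negP => h; move: lV.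
    by rewrite /l ltNge ltW// ln_lt0// v_gt0.
  have := wle _ pV0; rewrite (max_idPl vV) -ler_ln ?posrE ?w_gt0 ?v_gt0//.
  by rewrite -/(L _) -/(l _) LE// ger_pMl.
have powE (r : R) a : a != 0 -> abs_pow v r a = expR (r * l a).
  move=> a0; rewrite /abs_pow /trivial_norm (negbTE a0).
  case: eqP => [->|_]; first by rewrite mul0r expR0.
  by rewrite /powR gt_eqF// v_gt0.
exists rho; split.
  split; first by rewrite rho_ge0 rho_le1.
  move=> a; rewrite -/(w a); have [->|a0] := eqVneq a 0.
    rewrite w0 /abs_pow /trivial_norm eqxx; case: eqP => // /eqP r0.
    by rewrite v0 powR0.
  by rewrite powE// -LE// /L lnK// posrE w_gt0.
move=> r [_ /(_ p)]; rewrite -/(w p) powE// => /(congr1 (@ln R)).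
by rewrite expRK -/(L p) /rho => ->; rewrite mulfK ?lt_eqF.
Qed.

Lemma hybrid_mapP x : restricts_to_pow x (hybrid_map x).
Proof.
by have [r [rP _]] := restricts_to_pow_exists_unique x; apply: xgetPex; exists r.
Qed.

End HybridMapTheory.

Definition homotopic (R : realType) {X Y : topologicalType} (f g : X -> Y) :=
  exists H : X * R -> Y,
    [/\ {within [set: X] `*` `[0, 1], continuous H},
        forall x, H (x, 0) = f x &
        forall x, H (x, 1) = g x].

Definition homotopy_equivalence (R : realType) {X Y : topologicalType}
    (f : X -> Y) :=
  continuous f /\
  exists g : Y -> X,
    [/\ continuous g, homotopic R (g \o f) idfun & homotopic R (f \o g) idfun].

(* Main.v *)
From HB Require Import structures.
Require Import Defs.
From mathcomp Require Import all_boot all_order all_algebra.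
From mathcomp Require Import all_classical all_reals all_analysis.
From mathcomp Require Import lra.
(* The notations of mpoly clash with those already in scope. *)
From mathcomp Require mpoly.
Import -(notations) mathcomp.multinomials.mpoly.
Import Order.TTheory GRing.Theory Num.Theory.
Import numFieldNormedType.Exports.

(** Both the hybrid affine space and its trivial fibre are contractible, and
    one contraction serves for both: it ends at the trivial norm on k[T], which
    sends every nonzero polynomial to 1, and it preserves the trivial fibre.
    The constant map at the trivial norm is then a homotopy inverse of the
    inclusion.

    The contraction raises seminorms to powers s going to 0. Since x(f)^s tends
    to 1 if x(f) > 0 and to 0 if x(f) = 0, this is discontinuous in x as long as
    some x has a nonzero kernel. So kernels are removed first. Each x is
    ultrametric, because x(m) <= 1 for every natural number m
    ([hybrid_ultrametric]), and hence has a Gauss extension of radius r to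
    k[T][S], which is again multiplicative ([gauss_normM]). Composing it with
    the ring morphism f(T) |-> f(T + S) gives a seminorm x_r on k[T], the
    generic point of the polydisc of radius r around x ([inflate]). It equals x
    at r = 0 ([inflate0]), agrees with x on k ([inflateC]), depends continuously
    on (x, r) because only finitely many coefficients of f(T + S) are nonzero
    ([continuous_inflate]), and is a norm at r = 1 ([inflate1_gt0]).

    Run backwards from t = 1 to t = 0, the contraction therefore lets r grow
    from 0 to 1 with exponent 1, and then, with r = 1, lets the exponent
    decrease from 1 to 0 ([continuous_contraction]). On k it only replaces x by
    the powers x^s, so a trivial norm on k stays trivial
    ([contraction_trivial_fiber]). *)

Set Implicit Arguments.
Unset Strict Implicit.
Unset Printing Implicit Defensive.

Local Open Scope classical_set_scope.
Local Open Scope ring_scope.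

(** * Ultrametric seminorms *)

Section Ultrametric.
Context {R : realType} {B : comNzRingType} (x : B -> R).
Hypothesis xS : multiplicative_seminorm x.

Definition ultrametric := forall f g, x (f + g) <= Num.max (x f) (x g).

Lemma msnN f : x (- f) = x f.
Proof.
have xN1 : x (-1) = 1.
  apply/eqP; rewrite -(eqrXn2 (n := 2)) ?ler01 ?(msn_ge0 xS)//.
  by rewrite expr2 -(msnM xS) mulrN1 opprK (msn1 xS) expr1n.
by rewrite -mulN1r (msnM xS) xN1 mul1r.
Qed.

Lemma msn_sum I (s : seq I) (P : pred I) (F : I -> B) :
  x (\sum_(i <- s | P i) F i) <= \sum_(i <- s | P i) x (F i).
Proof.
apply: (big_ind2 (fun f c => x f <= c)) => [|f c g d fc gd|//].
  by rewrite (msn0 xS).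
by apply: (le_trans (msnD xS f g)); rewrite lerD.
Qed.

Lemma msnX f m : x (f ^+ m) = x f ^+ m.
Proof.
by elim: m => [|m IH]; rewrite ?expr0 ?(msn1 xS)// !exprS (msnM xS) IH.
Qed.

(** The binomial formula bounds x(f + g)^m by (m + 1) M^m with
    M = max (x f) (x g); as m + 1 is eventually smaller than c^m for every
    c > 1, this forces x(f + g) <= M. *)
Lemma msn_natr_le1_ultrametric : (forall m, x m%:R <= 1) -> ultrametric.
Proof.
move=> xnat f g; set M := Num.max _ _.
have M0 : 0 <= M by rewrite le_max (msn_ge0 xS).
have pow_le m : x (f + g) ^+ m <= m.+1%:R * M ^+ m.
  rewrite -msnX exprDn; apply: (le_trans (msn_sum _ _ _)).
  rewrite mulr_natl -[m.+1 in X in _ <= X]card_ord -sumr_const.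
  apply: ler_sum => i _; rewrite -[_ *+ 'C(m, i)]mulr_natr (msnM xS).
  rewrite -[leRHS]mulr1; apply: ler_pM; rewrite ?(msn_ge0 xS)//.
  have -> : M ^+ m = M ^+ (m - i) * M ^+ i by rewrite -exprD subnK// leq_ord.
  rewrite (msnM xS) !msnX.
  by apply: ler_pM; rewrite ?exprn_ge0 ?(msn_ge0 xS)// lerXn2r ?nnegrE
    ?(msn_ge0 xS)// le_max lexx ?orbT.
rewrite leNgt; apply/negP => Mlt.
have pos_M : 0 < M.
  rewrite lt_neqAle M0 andbT; apply/eqP => M00.
  by have := pow_le 1%N; rewrite !expr1 -M00 mulr0 leNgt M00 Mlt.
pose d := x (f + g) / M - 1.
have d0 : 0 < d by rewrite subr_gt0 ltr_pdivlMr// mul1r.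
have bern m : 1 + m%:R * d <= (1 + d) ^+ m.
  elim: m => [|m IH]; first by rewrite mul0r addr0 expr0.
  have md0 : 0 <= m%:R * d by rewrite mulr_ge0// ltW.
  by rewrite exprS -natr1; nra.
have grow m : (1 + d) ^+ m <= m.+1%:R.
  by rewrite /d addrC subrK expr_div_n ler_pdivrMr ?exprn_gt0.
(* The exponent 2m gives a quadratic lower bound (1 + m d)^2, which exceeds
   2m + 1 as soon as m d^2 > 2. *)
pose m := (Num.bound (2 / d ^+ 2)).+1.
have md : 2 < m%:R * d ^+ 2.
  rewrite -ltr_pdivrMr ?exprn_gt0//.
  apply: (@lt_trans _ _ (Num.bound (2 / d ^+ 2))%:R).
    by apply: archi_boundP; rewrite divr_ge0 ?exprn_ge0 ?ltW.
  by rewrite ltr_nat.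
have := grow (m * 2)%N; rewrite exprM leNgt => /negP; apply.
have : (1 + m%:R * d) ^+ 2 <= ((1 + d) ^+ m) ^+ 2.
  have d1 : 0 <= 1 + d by rewrite addr_ge0// ltW.
  by rewrite lerXn2r ?nnegrE ?bern ?exprn_ge0// addr_ge0// mulr_ge0// ltW.
apply: lt_le_trans; rewrite -natr1 natrM.
have m1 : 1 <= m%:R :> R by rewrite ler1n.
have : 0 < m%:R * d by rewrite mulr_gt0// (lt_le_trans ltr01).
nra.
Qed.

Hypothesis xU : ultrametric.

(** The factor d stands for the power r^|m| of the radius by which Gauss norms
    weight the coefficient of a monomial m; at radius 0 it vanishes, so it
    cannot be absorbed into the bound c by division. *)
Lemma ultrametric_sum_le I (s : seq I) (P : pred I) (F : I -> B) (c d : R) :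
  0 <= c -> 0 <= d -> (forall i, P i -> x (F i) * d <= c) ->
  x (\sum_(i <- s | P i) F i) * d <= c.
Proof.
move=> c0 d0 Fc; apply: (big_ind (fun f => x f * d <= c)) => //.
  by rewrite (msn0 xS) mul0r.
move=> f g fc gc; apply: (le_trans (ler_wpM2r d0 (xU f g))).
by rewrite maxr_pMl// ge_max fc.
Qed.

Lemma ultrametric_sum_lt I (s : seq I) (P : pred I) (F : I -> B) (c d : R) :
  0 < c -> 0 <= d -> (forall i, P i -> x (F i) * d < c) ->
  x (\sum_(i <- s | P i) F i) * d < c.
Proof.
move=> c0 d0 Fc; apply: (big_ind (fun f => x f * d < c)) => //.
  by rewrite (msn0 xS) mul0r.
move=> f g fc gc; apply: (le_lt_trans (ler_wpM2r d0 (xU f g))).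
by rewrite maxr_pMl// gt_max fc.
Qed.

Lemma ultrametricD_dominant f g : x g < x f -> x (f + g) = x f.
Proof.
move=> gf; apply/eqP; rewrite eq_le; apply/andP; split.
  by apply: (le_trans (xU f g)); rewrite ge_max lexx ltW.
have := xU (f + g) (- g); rewrite addrK msnN le_max => /orP[//|].
by rewrite leNgt gf.
Qed.

End Ultrametric.

(** * Gauss norms on polynomial rings *)

Section GaussNorm.
Context {R : realType} {B : comNzRingType} {n : nat}.
Variables (x : B -> R) (r : R).
Hypotheses (xS : multiplicative_seminorm x) (xU : ultrametric x) (r0 : 0 <= r).
Implicit Types (f g : mpoly n B) (m : multinom n).

Definition gauss_term f m : R := x (mcoeff m f) * r ^+ mdeg m.

Definition gauss_norm f : R := \big[Num.max/0]_(m <- msupp f) gauss_term f m.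

Let term_ge0 f m : 0 <= gauss_term f m.
Proof. by rewrite mulr_ge0 ?(msn_ge0 xS) ?exprn_ge0. Qed.

Lemma gauss_norm_ge0 f : 0 <= gauss_norm f.
Proof. exact: bigmax_ge_id. Qed.

Lemma gauss_term_le f m : gauss_term f m <= gauss_norm f.
Proof.
have [mf|/memN_msupp_eq0 fm0] := boolP (m \in msupp f).
  exact: (le_bigmax_seq 0 _ _ (gauss_term f) mf isT).
by rewrite {1}/gauss_term fm0 (msn0 xS) mul0r gauss_norm_ge0.
Qed.

Lemma gauss_norm_le f c :
  0 <= c -> (forall m, gauss_term f m <= c) -> gauss_norm f <= c.
Proof. by move=> c0 fc; apply: bigmax_le. Qed.

(** Among the finitely many monomials with a maximal term there is a greatest
    one for the monomial order; all terms beyond it are strictly smaller. *)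
Lemma gauss_norm_attained f : 0 < gauss_norm f ->
  exists m, gauss_term f m = gauss_norm f /\
    forall m', (m < m')%O -> gauss_term f m' < gauss_norm f.
Proof.
move=> f0.
pose s := [seq m <- msupp f | gauss_term f m == gauss_norm f].
have sP m : gauss_term f m = gauss_norm f -> m \in s.
  move=> e; rewrite mem_filter e eqxx/= mcoeff_msupp; apply/eqP => fm0.
  by move: f0; rewrite -e /gauss_term fm0 (msn0 xS) mul0r ltxx.
have [m0 m0s] : exists m, m \in s.
  have : gauss_norm f = 0 \/ exists m, gauss_norm f = gauss_term f m.
    rewrite /gauss_norm.
    apply: (big_ind (fun c => c = 0 \/ exists m, c = gauss_term f m)).
    - by left.
    - by move=> a b a_f b_f; case: leP.
    - by move=> m _; right; exists m.
  move=> [f00|[m mE]]; first by move: f0; rewrite f00 ltxx.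
  by exists m; apply: sP.
pose M := \big[Order.max/m0]_(m <- s) m.
have Ms : M \in s.
  rewrite /M big_seq; apply: (big_ind (fun m => m \in s)) => // a b.
  by case: leP.
exists M; split; first by move: Ms; rewrite mem_filter => /andP[/eqP].
move=> m' Mm'; rewrite lt_neqAle gauss_term_le andbT; apply/eqP => /sP m's.
by have := le_bigmax_seq m0 _ xpredT id m's isT; rewrite leNgt Mm'.
Qed.

(** Gauss's lemma. Each coefficient of f g is a sum of products of coefficients,
    so the ultrametric inequality gives one bound. For the other, let m1 and m2
    be the greatest monomials with maximal terms in f and in g: in the
    coefficient of m1 + m2, every other pair (i, j) with i + j = m1 + m2 has
    i > m1 or j > m2, so the product at (m1, m2) strictly dominates. *)
Lemma gauss_normM f g : gauss_norm (f * g) = gauss_norm f * gauss_norm g.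
Proof.
have termM m i j : m = mnm_add i j ->
    x (mcoeff i f * mcoeff j g) * r ^+ mdeg m = gauss_term f i * gauss_term g j.
  by move=> ->; rewrite (msnM xS) mdegD exprD mulrACA.
apply/eqP; rewrite eq_le; apply/andP; split.
  apply: gauss_norm_le => [|m]; first by rewrite mulr_ge0 ?gauss_norm_ge0.
  rewrite /gauss_term mcoeffM; apply: ultrametric_sum_le => //.
  - by rewrite mulr_ge0 ?gauss_norm_ge0.
  - by rewrite exprn_ge0.
  move=> i /eqP /termM ->.
  by rewrite ler_pM ?term_ge0 ?gauss_term_le.
have [f0|f0] := leP (gauss_norm f) 0.
  suff -> : gauss_norm f = 0 by rewrite mul0r gauss_norm_ge0.
  by apply/eqP; rewrite eq_le f0 gauss_norm_ge0.
have [g0|g0] := leP (gauss_norm g) 0.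
  suff -> : gauss_norm g = 0 by rewrite mulr0 gauss_norm_ge0.
  by apply/eqP; rewrite eq_le g0 gauss_norm_ge0.
have [m1 [m1E m1max]] := gauss_norm_attained f0.
have [m2 [m2E m2max]] := gauss_norm_attained g0.
pose m := mnm_add m1 m2.
have m1m : (mdeg m1 < (mdeg m).+1)%N by rewrite /m mdegD ltnS leq_addr.
have m2m : (mdeg m2 < (mdeg m).+1)%N by rewrite /m mdegD ltnS leq_addl.
rewrite -m1E -m2E -(termM m)//.
apply: le_trans (gauss_term_le (f * g) m); rewrite /gauss_term.
rewrite mcoeffM (bigD1 (BMultinom m1m, BMultinom m2m))//=.
rewrite ultrametricD_dominant//.
have rest : x (\sum_(i : bmultinom n (mdeg m).+1 * bmultinom n (mdeg m).+1 |
      (m == mnm_add i.1 i.2) && (i != (BMultinom m1m, BMultinom m2m)))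
    mcoeff i.1 f * mcoeff i.2 g) * r ^+ mdeg m < gauss_norm f * gauss_norm g.
  apply: ultrametric_sum_lt => //; rewrite ?mulr_gt0 ?exprn_ge0//.
  move=> [i j]/= /andP[/eqP mij ij]; rewrite (termM _ _ _ mij).
  have [m1i|im1|m1i] := ltgtP m1 (i : multinom n).
  - apply: (@le_lt_trans _ _ (gauss_term f i * gauss_norm g)).
      by rewrite ler_wpM2l ?term_ge0 ?gauss_term_le.
    by rewrite ltr_pM2r// m1max.
  - have m2j : (m2 < (j : multinom n))%O.
      rewrite ltNge; apply/negP => jm2.
      by have := ltmc_le_add im1 jm2; rewrite -mij ltxx.
    apply: (@le_lt_trans _ _ (gauss_norm f * gauss_term g j)).
      by rewrite ler_wpM2r ?term_ge0 ?gauss_term_le.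
    by rewrite ltr_pM2l// m2max.
  - case/eqP: ij; congr pair; apply/val_inj => //=.
    by move: mij; rewrite /m -m1i => /eqP; rewrite eqm_add2l => /eqP.
rewrite ltNge; apply/negP => hle; move: rest; rewrite ltNge => /negP; apply.
rewrite -m1E -m2E -(termM m)//; apply: ler_wpM2r => //.
by rewrite exprn_ge0.
Qed.

Lemma gauss_norm_ultrametric : ultrametric gauss_norm.
Proof.
move=> f g; apply: gauss_norm_le => [|m].
  by rewrite le_max gauss_norm_ge0.
rewrite /gauss_term mcoeffD.
apply: (le_trans (ler_wpM2r _ (xU _ _))); first by rewrite exprn_ge0.
rewrite maxr_pMl ?exprn_ge0// ge_max !le_max.
by rewrite !gauss_term_le orbT.
Qed.

Lemma gauss_normC a : gauss_norm (mpolyC n a) = x a.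
Proof.
apply/eqP; rewrite eq_le; apply/andP; split.
  apply: gauss_norm_le => [|m]; first exact: (msn_ge0 xS).
  rewrite /gauss_term mcoeffC; have [->|_] := eqVneq.
    by rewrite mulr1 mdeg0 expr0 mulr1.
  by rewrite mulr0 (msn0 xS) mul0r (msn_ge0 xS).
have := gauss_term_le (mpolyC n a) (@mnm0 n).
by rewrite {1}/gauss_term mcoeffC eqxx mulr1 mdeg0 expr0 mulr1.
Qed.

Lemma gauss_norm_seminorm : multiplicative_seminorm gauss_norm.
Proof.
split.
- exact: gauss_norm_ge0.
- by rewrite -(mpolyC0 n) gauss_normC (msn0 xS).
- by rewrite -(mpolyC1 n) gauss_normC (msn1 xS).
- exact: gauss_normM.
- move=> f g; apply: (le_trans (gauss_norm_ultrametric f g)).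
  by rewrite ge_max lerDl lerDr !gauss_norm_ge0.
Qed.

End GaussNorm.

(** * Translation by a generic vector *)

Section Translation.
Context {n : nat} {A : comNzRingType}.
Local Notation P := (mpoly n A).
Local Notation coord i := (mpolyX A (mnm1 i) : P).
Local Notation shift i := (mpolyX P (mnm1 i) : mpoly n P).

(** The Taylor expansion f(T) |-> f(T + S), seen as a polynomial in S with
    coefficients in A[T]. *)
Definition translate : P -> mpoly n P :=
  mmap (@mpolyC n P \o @mpolyC n A)
    (fun i => mpolyC n (coord i) + shift i).

HB.instance Definition _ := GRing.RMorphism.on translate.

(** The substitution S |-> S - T, linear over A[T]. *)
Definition untranslate : mpoly n P -> mpoly n P :=
  mmap (@mpolyC n P) (fun i => shift i - mpolyC n (coord i)).

HB.instance Definition _ := GRing.RMorphism.on untranslate.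

Lemma translateC a : translate (mpolyC n a) = mpolyC n (mpolyC n a).
Proof. exact: mmapC. Qed.

Lemma rmorph_mmap1 (S T : comNzRingType) (phi : {rmorphism S -> T})
  (h : 'I_n -> S) (m : multinom n) : phi (mmap1 h m) = mmap1 (phi \o h) m.
Proof.
by rewrite /mmap1 rmorph_prod; apply: eq_bigr => i _; rewrite rmorphXn.
Qed.

Lemma translateK f : untranslate (translate f) = map_mpoly (@mpolyC n A) f.
Proof.
elim/mpolyind: f => [|c m f _ _ IH].
  by rewrite /translate /untranslate /map_mpoly !mmap0.
rewrite /map_mpoly mmapD mmapZ mmapX -/(map_mpoly _ f) -IH.
rewrite {1}/translate mmapD mmapZ mmapX -/(translate f).
rewrite /untranslate mmapD; congr (_ + _).
rewrite -/untranslate rmorphM rmorph_mmap1 /= /untranslate mmapC.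
congr (_ * _); apply: mmap1_eq => i /=.
by rewrite mmapD mmapC mmapX mmap1U addrC subrK.
Qed.

Lemma mcoeff0_translate f : mcoeff mnm0 (translate f) = f.
Proof.
elim/mpolyind: f => [|c m f _ _ IH].
  by rewrite /translate mmap0 mcoeff0.
rewrite /translate mmapD mmapZ mmapX -/(translate f) mcoeffD IH; congr (_ + _).
rewrite rmorphM rmorph_mmap1 /= mpolyCK -mul_mpolyC -[in RHS]mmap1_id.
congr (_ * _); apply: mmap1_eq => i /=.
by rewrite mcoeffD mpolyCK mcoeffX -mdeg_eq0 mdeg1 addr0.
Qed.

End Translation.

(** * Inflating a point to a polydisc *)

Section Inflation.
Context {R : realType} {k : fieldType} {n : nat} (x : mpoly n k -> R).
Hypotheses (xS : multiplicative_seminorm x) (xU : ultrametric x).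

(** The generic point of the polydisc of radius r around x; explicitly the
    maximum over m of x(D_m f) r^|m|, where the D_m f are the Hasse derivatives,
    which are the coefficients of f(T + S). *)
Definition inflate (r : R) (f : mpoly n k) : R := gauss_norm x r (translate f).

Lemma inflate_seminorm r : 0 <= r -> multiplicative_seminorm (inflate r).
Proof.
move=> r0; have [g0 gz g1 gM gD] := gauss_norm_seminorm (n := n) xS xU r0.
by split=> [f|||f g|f g]; rewrite /inflate ?rmorph0 ?rmorph1 ?rmorphM ?rmorphD.
Qed.

Lemma inflate_ultrametric r : 0 <= r -> ultrametric (inflate r).
Proof.
by move=> r0 f g; rewrite /inflate rmorphD; apply: gauss_norm_ultrametric.
Qed.

Lemma inflateC r a : 0 <= r -> inflate r (mpolyC n a) = x (mpolyC n a).
Proof. by move=> r0; rewrite /inflate translateC gauss_normC. Qed.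

Lemma inflate0 f : inflate 0 f = x f.
Proof.
rewrite /inflate -{2}(mcoeff0_translate f); apply/eqP; rewrite eq_le.
apply/andP; split; last first.
  have := gauss_term_le 0 xS (translate f) (@mnm0 n).
  by rewrite /gauss_term mdeg0 expr0 mulr1.
apply: gauss_norm_le => [|m]; first exact: (msn_ge0 xS).
rewrite /gauss_term expr0n mdeg_eq0; case: eqVneq => [->|_].
  by rewrite mulr1.
by rewrite mulr0 (msn_ge0 xS).
Qed.

Lemma msnC_gt0 a : a != 0 -> 0 < x (mpolyC n a).
Proof.
move=> a0; rewrite lt_def (msn_ge0 xS) andbT; apply/eqP => xa.
have := msn1 xS; rewrite -(mpolyC1 n) -(divff a0) mpolyCM (msnM xS) xa mul0r.
by move/esym/eqP; rewrite oner_eq0.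
Qed.

(** If the Gauss norm of f(T + S) vanishes, all coefficients of f(T + S) lie in
    the kernel of x, an ideal of k[T]. The substitution S |-> S - T, linear over
    k[T], keeps the coefficients in that ideal and turns f(T + S) into f(S),
    whose coefficients are in k, where x vanishes only at 0. *)
Lemma inflate1_gt0 f : f != 0 -> 0 < inflate 1 f.
Proof.
have GS := gauss_norm_seminorm (n := n) xS xU (@ler01 R).
move=> f0; rewrite lt_def (msn_ge0 GS) andbT; apply: contra_neq f0 => Gf.
have coef0 m : x (mcoeff m (translate f)) = 0.
  apply/eqP; rewrite eq_le (msn_ge0 xS) andbT -{}Gf.
  have := gauss_term_le 1 xS (translate f) m.
  by rewrite /gauss_term expr1n mulr1.
have Gid : gauss_norm x 1 (untranslate (translate f)) = 0.
  apply/eqP; rewrite eq_le (msn_ge0 GS) andbT /untranslate /mmap.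
  apply: (le_trans (msn_sum GS _ _ _)); rewrite big1// => m _.
  by rewrite (msnM GS) gauss_normC// coef0 mul0r.
apply/mpolyP => m; rewrite mcoeff0; apply/eqP; apply/negPn/negP => fm0.
have := gauss_term_le 1 xS (map_mpoly (@mpolyC n k) f) m.
rewrite -{2}translateK Gid /gauss_term mcoeff_map_mpoly expr1n mulr1.
by rewrite leNgt msnC_gt0.
Qed.

End Inflation.

(** * Powers of inflated hybrid points *)

Section HybridPoints.
Context {R : realType} {k : fieldType} (v : k -> R) (n : nat).
Hypothesis v_abs : nonarchimedean_absolute_value v.
Local Notation A_hyb := (hybrid_affine_space v n).
Implicit Types (x : A_hyb) (r s : R) (f g : mpoly n k).

Lemma natr_absv_le1 m : v m%:R <= 1.
Proof.
have v1 : v 1 <= 1.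
  have [->//|v1n0] := eqVneq (v 1) 0.
  suff -> : v 1 = 1 by [].
  by apply: (mulfI v1n0); rewrite -(absvM v_abs) !mulr1.
elim: m => [|m IH]; first by rewrite mulr0n ((absv_eq0 v_abs 0).2 erefl).
rewrite -natr1; apply: (le_trans (absv_ultra v_abs _ _)).
by rewrite ge_max IH.
Qed.

Lemma hybrid_ultrametric x : ultrametric (sval x).
Proof.
have [xS xle] := proj2_sig x; apply: (msn_natr_le1_ultrametric xS) => m.
rewrite -(mpolyC_nat n); apply: (le_trans (xle _)).
by rewrite /hybrid_norm ge_max natr_absv_le1 /trivial_norm; case: eqP => _ /=.
Qed.

(** The case f = 0 is separate because [powR] gives 0 `^ 0 = 1. *)
Definition inflate_pow x r s f : R :=
  if f == 0 then 0 else inflate (sval x) r f `^ s.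

(** Powers of a multiplicative seminorm stay subadditive because the seminorm is
    ultrametric. *)
Lemma inflate_powP x r s : 0 <= r -> 0 <= s <= 1 ->
  multiplicative_seminorm (inflate_pow x r s) /\
  forall a, inflate_pow x r s (mpolyC n a) <= hybrid_norm v a.
Proof.
move=> r0 /andP[s0 s1]; have [xS xle] := proj2_sig x.
have xU := hybrid_ultrametric x.
have iS := inflate_seminorm xS xU r0.
split; last first.
  move=> a; rewrite /inflate_pow mpolyC_eq0; have [a0|a0] := eqVneq.
    by rewrite /hybrid_norm le_max (absv_ge0 v_abs).
  rewrite inflateC//; have := xle a.
  rewrite /hybrid_norm /trivial_norm (negbTE a0); set c := Num.max _ _ => xac.
  have c1 : 1 <= c by rewrite le_max lexx orbT.
  apply: (@le_trans _ _ (c `^ s)).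
    by rewrite ge0_ler_powR// nnegrE ?(msn_ge0 xS)// (le_trans ler01).
  by rewrite -[leRHS]powRr1 ?ler_powR// (le_trans ler01).
split.
- by move=> f; rewrite /inflate_pow; case: ifP => // _; rewrite powR_ge0.
- by rewrite /inflate_pow eqxx.
- by rewrite /inflate_pow oner_eq0 (msn1 iS) powR1.
- move=> f g; rewrite /inflate_pow mulf_eq0.
  have [_|f0] := eqVneq f 0; first by rewrite mul0r.
  have [_|g0] := eqVneq g 0; first by rewrite mulr0.
  by rewrite (msnM iS) powRM ?(msn_ge0 iS).
move=> f g; have [->|f0] := eqVneq f 0.
  by rewrite {2}/inflate_pow eqxx !add0r.
have [->|g0] := eqVneq g 0; first by rewrite {3}/inflate_pow eqxx !addr0.
rewrite /inflate_pow (negbTE f0) (negbTE g0).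
case: ifP => _; first by rewrite addr_ge0// powR_ge0.
have pow_mono a b : 0 <= a -> a <= b -> a `^ s <= b `^ s.
  by move=> a0 ab; rewrite ge0_ler_powR// nnegrE (le_trans a0).
have fg0 := msn_ge0 iS (f + g).
have := inflate_ultrametric xS xU r0 f g; rewrite le_max => /orP[] h.
  by apply: ler_wpDr (pow_mono _ _ fg0 h); exact: powR_ge0.
by apply: ler_wpDl (pow_mono _ _ fg0 h); exact: powR_ge0.
Qed.

End HybridPoints.

(** * Continuity into the hybrid affine space *)

Section Continuity.
Context {R : realType} {Z : topologicalType}.

Lemma continuous_bigmax I (s : seq I) (F : I -> Z -> R) :
  (forall i, continuous (F i)) ->
  continuous (fun z => \big[Num.max/0]_(i <- s) F i z).
Proof.
move=> Fc z; elim: s => [|i s IH].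
  by under eq_fun do rewrite big_nil; exact: cvg_cst.
by under eq_fun do rewrite big_cons; apply: continuous_max => //; exact: Fc.
Qed.

Lemma continuous_near_eq (g h : Z -> R) z : (\forall y \near z, g y = h y) ->
  {for z, continuous g} -> {for z, continuous h}.
Proof.
move=> gh gc; have gz : g z = h z := nbhs_singleton gh.
rewrite /prop_for /continuous_at -gz; apply: cvg_trans gc.
exact: near_eq_cvg.
Qed.

Lemma continuous_powR (g h : Z -> R) z : 0 < g z ->
  {for z, continuous g} -> {for z, continuous h} ->
  {for z, continuous (fun z => g z `^ h z)}.
Proof.
move=> gz gc hc.
have powE : \forall y \near z, expR (h y * ln (g y)) = g y `^ h y.
  have : \forall y \near z, 0 < g y by apply: (cvgr_gt (g z)).
  by apply: filterS => y gy; rewrite /powR gt_eqF.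
apply: (continuous_near_eq powE).
apply: continuous_cvg; first exact: continuous_expR.
apply: cvgM => //; apply: continuous_cvg => //; exact: continuous_ln.
Qed.

Context {k : fieldType} {v : k -> R} {n : nat}.
Local Notation A_hyb := (hybrid_affine_space v n).

Lemma continuous_seminorm_eval (f : mpoly n k) :
  continuous (seminorm_eval f : A_hyb -> R).
Proof.
move=> x; have /cvg_sup/(_ f) : nbhs x --> x by [].
move=> h; apply: cvg_trans (@initial_continuous _ _ (seminorm_eval f) x).
exact: cvg_app.
Qed.

Lemma continuous_to_hybrid (F : Z -> A_hyb) :
  (forall f, continuous (fun z => seminorm_eval f (F z))) -> continuous F.
Proof.
move=> Fc z; apply/cvg_sup => f.
exact: (@continuous_comp_initial _ _ _ (seminorm_eval f) F (Fc f)).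
Qed.

Lemma continuous_inflate (X : Z -> A_hyb) (r : Z -> R) (f : mpoly n k) :
  continuous X -> continuous r ->
  continuous (fun z => inflate (sval (X z)) (r z) f).
Proof.
move=> Xc rc; apply: continuous_bigmax => m z; apply: cvgM.
  apply: (@continuous_comp _ _ _ X (seminorm_eval _)); first exact: Xc.
  exact: continuous_seminorm_eval.
apply: (@continuous_comp _ _ _ r (fun u => u ^+ _)); first exact: rc.
exact: exprn_continuous.
Qed.

End Continuity.

(** * The contraction *)

Section Contraction.
Context {R : realType} {k : fieldType} {v : k -> R} {n : nat}.
Hypothesis v_abs : nonarchimedean_absolute_value v.
Local Notation A_hyb := (hybrid_affine_space v n).
Implicit Types (x : A_hyb) (t : R) (f : mpoly n k).

(** Clipping the parameter to [0, 1] makes the contraction below a total and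
    continuous function of t in R. *)
Definition clip t : R := Num.min 1 (Num.max 0 t).

Lemma clip_itv t : 0 <= clip t <= 1.
Proof. by rewrite /clip ge_min le_min lexx ler01 le_max lexx. Qed.

Lemma clip_le0 t : t <= 0 -> clip t = 0.
Proof. by move=> t0; rewrite /clip (max_idPl t0) (min_idPr ler01). Qed.

Lemma clip_ge1 t : 1 <= t -> clip t = 1.
Proof.
by move=> t1; rewrite /clip; apply/min_idPl; rewrite le_max t1 orbT.
Qed.

Lemma continuous_clip : continuous clip.
Proof.
move=> t; apply: continuous_min; first exact: cst_continuous.
by apply: continuous_max; [exact: cst_continuous|exact: cvg_id].
Qed.

(** As t goes from 0 to 1, first the exponent grows from 0 to 1 at radius 1,
    then the radius decreases from 1 to 0 at exponent 1. *)
Definition radius t := clip (2 - 2 * t).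
Definition exponent t := clip (2 * t).

Definition contraction x t : A_hyb :=
  exist _ (inflate_pow x (radius t) (exponent t))
    (inflate_powP v_abs x (proj1 (andP (clip_itv _))) (clip_itv _)).

Lemma hybrid_point_eq x y :
  (forall f, seminorm_eval f x = seminorm_eval f y) -> x = y.
Proof.
move=> xy; apply: eq_sig_hprop; last exact/funext.
by move=> z p q; exact: Prop_irrelevance.
Qed.

Lemma trivial_pointP :
  multiplicative_seminorm (fun f : mpoly n k => (f != 0)%:R : R) /\
  forall a : k, (mpolyC n a != 0)%:R <= hybrid_norm v a.
Proof.
split; last first.
  move=> a; rewrite mpolyC_eq0 /hybrid_norm /trivial_norm le_max.
  by case: eqVneq; rewrite lexx orbT.
split=> [f|||f g|f g]; rewrite ?eqxx ?oner_eq0 ?ler0n//.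
  by rewrite mulf_eq0 negb_or -natrM mulnb.
have [->|f0] := eqVneq f 0; first by rewrite add0r lerDr ler0n.
have [->|g0] := eqVneq g 0; first by rewrite addr0 f0 lerDl.
by rewrite -natrD ler_nat; case: eqP.
Qed.

Definition trivial_point : A_hyb := exist _ _ trivial_pointP.

Lemma contraction0 x : contraction x 0 = trivial_point.
Proof.
apply: hybrid_point_eq => f.
rewrite /seminorm_eval/= /inflate_pow /exponent mulr0 clip_le0// powRr0.
by case: eqP.
Qed.

Lemma contraction1 x : contraction x 1 = x.
Proof.
have [xS _] := proj2_sig x.
apply: hybrid_point_eq => f; rewrite /seminorm_eval/= /inflate_pow.
rewrite /radius /exponent mulr1 subrr clip_le0// clip_ge1 ?ler1n//.
rewrite inflate0// powRr1 ?(msn_ge0 xS)//.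
by case: eqP => // ->; rewrite (msn0 xS).
Qed.

(** The function (a, s) |-> a^s is continuous where a > 0. For t <= 1/2 the base
    is a value of the inflation of radius 1, hence positive; for t > 1/2 the
    exponent is 1, so that no power is taken near t. *)
Lemma continuous_contraction (Z : topologicalType)
    (X : Z -> A_hyb) (T : Z -> R) :
  continuous X -> continuous T -> continuous (fun z => contraction (X z) (T z)).
Proof.
move=> Xc Tc; apply: continuous_to_hybrid => f z.
rewrite /seminorm_eval/= /inflate_pow.
have [_|f0] := eqVneq f 0; first exact: cvg_cst.
have rc : continuous (fun y => radius (T y)).
  move=> y; apply: (@continuous_comp _ _ _ (fun y => 2 - 2 * T y) clip).
    by apply: cvgB; [exact: cvg_cst|apply: cvgM; [exact: cvg_cst|exact: Tc]].
  exact: continuous_clip.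
have sc : continuous (fun y => exponent (T y)).
  move=> y; apply: (@continuous_comp _ _ _ (fun y => 2 * T y) clip).
    by apply: cvgM; [exact: cvg_cst|exact: Tc].
  exact: continuous_clip.
have ic := continuous_inflate (f := f) Xc rc.
have [Tz|Tz] := leP (T z) (1 / 2).
  apply: (continuous_powR _ (ic z) (sc z)).
  have [xS _] := proj2_sig (X z).
  rewrite /radius /= clip_ge1; last by lra.
  by apply: inflate1_gt0 => //; exact: hybrid_ultrametric.
have powE : \forall y \near z,
    inflate (sval (X y)) (radius (T y)) f =
    inflate (sval (X y)) (radius (T y)) f `^ exponent (T y).
  have : \forall y \near z, 1 / 2 < T y.
    by apply: (cvgr_gt (T z)) => //; exact: Tc.
  apply: filterS => y Ty; have [xS _] := proj2_sig (X y).
  rewrite /exponent clip_ge1; last by lra.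
  rewrite powRr1//; apply: msn_ge0; apply: inflate_seminorm => //.
    exact: hybrid_ultrametric.
  by case/andP: (clip_itv (2 - 2 * T y)).
exact: (continuous_near_eq powE (ic z)).
Qed.

Hypothesis v_nontriv : nontrivial_absolute_value v.

Lemma trivial_fiberP x : trivial_fiber v n x <->
  forall a, seminorm_eval (mpolyC n a) x = trivial_norm a.
Proof.
have xc := hybrid_mapP v_abs v_nontriv x.
rewrite /trivial_fiber /=; split=> [h0 a|xa].
  by have [_ /(_ a)] := xc; rewrite h0 /abs_pow eqxx.
have [c [_ cU]] := restricts_to_pow_exists_unique v_abs v_nontriv x.
rewrite -(cU _ xc); apply: cU.
by split=> [|a]; rewrite ?lexx ?ler01// xa /abs_pow eqxx.
Qed.

Lemma trivial_point_fiber : trivial_fiber v n trivial_point.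
Proof.
apply/trivial_fiberP => a.
by rewrite /seminorm_eval /= mpolyC_eq0 /trivial_norm; case: eqP.
Qed.

Lemma contraction_trivial_fiber x t :
  trivial_fiber v n x -> trivial_fiber v n (contraction x t).
Proof.
move=> /trivial_fiberP xa; apply/trivial_fiberP => a.
have [xS _] := proj2_sig x.
have /andP[r0 _] := clip_itv (2 - 2 * t).
rewrite /seminorm_eval/= /inflate_pow mpolyC_eq0 /trivial_norm.
case: eqVneq => // a0; rewrite (inflateC xS)//.
have := xa a; rewrite /seminorm_eval => ->.
by rewrite /trivial_norm (negbTE a0) powR1.
Qed.

End Contraction.

(** * The homotopy equivalence *)

Theorem theoremC (R : realType) (k : fieldType) (v : k -> R)
    (v_abs : nonarchimedean_absolute_value v)
    (v_nontrivial : nontrivial_absolute_value v)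
    (v_complete : complete_absolute_value v)
    (n : nat) (n_ge1 : (1 <= n)%N) :
  homotopy_equivalence R
    (set_val : set_type (trivial_fiber v n) -> hybrid_affine_space v n).
Proof.
pose A_triv := set_type (trivial_fiber v n).
have val_continuous : continuous (set_val : A_triv -> hybrid_affine_space v n).
  exact: initial_continuous.
split=> //.
have triv (y : A_triv) t :
  contraction v_abs (set_val y) t \in trivial_fiber v n.
  apply/mem_set/(contraction_trivial_fiber v_abs v_nontrivial).
  exact: set_valP.
pose in_triv x (xt : x \in trivial_fiber v n) : A_triv :=
  exist (fun x => x \in trivial_fiber v n) x xt.
have base_triv := mem_set (trivial_point_fiber (n := n) v_abs v_nontrivial).
exists (fun=> in_triv _ base_triv); split.
- exact: cst_continuous.
- exists (fun yt => in_triv _ (triv yt.1 yt.2)); split.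
  + apply: continuous_subspaceT.
    apply: continuous_comp_initial.
    apply: (@continuous_contraction _ _ _ _ v_abs _
      (fun yt : A_triv * R => set_val yt.1) snd) => yt.
      apply: continuous_comp; first exact: cvg_fst.
      exact: val_continuous.
    exact: cvg_snd.
  + by move=> y; apply/val_inj; rewrite /= contraction0.
  + by move=> y; apply/val_inj; rewrite /= contraction1.
- exists (fun xt => contraction v_abs xt.1 xt.2); split.
  + apply: continuous_subspaceT; apply: continuous_contraction => xt.
      exact: cvg_fst.
    exact: cvg_snd.
  + by move=> x; rewrite contraction0.
  + by move=> x; rewrite contraction1.
Qed.
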